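(* There exist constants $C\ge1$ and $\delta>0$ such that for every $k\in\mathbb{N}$ there is a matrix $\mathcal{E}$ with integer coefficients, of size $n\times k$, satisfying: (1) $n\le Ck$; (2) for every prime number $p$, the linear subspace $\Phi_p(\mathcal{C}(\mathcal{E}))\le\mathbb{F}_p^n$ is an $[n,k,\delta n]_p$-code.
   Context: For an integer $n\times k$ matrix $\mathcal{E}$, $\mathcal{C}(\mathcal{E})\le\mathbb{Z}^n$ is the image of the homomorphism $\mathbb{Z}^k\to\mathbb{Z}^n$, $v\mapsto\mathcal{E}v$, i.e. the subgroup generated by the columns of $\mathcal{E}$. $\Phi_p:\mathbb{Z}^n\to\mathbb{F}_p^n$ is coordinatewise reduction mod $p$. An $[n,k,d]_p$-code is a $k$-dimensional linear subspace of $\mathbb{F}_p^n$ in which any two distinct vectors have Hamming distance (number of coordinates where they differ) at least $d$; equivalently every non-zero vector has at least $d$ non-zero coordinates. *)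

(* Defs.v *)
From mathcomp Require Import all_boot all_order all_algebra.
From mathcomp Require Import classical_sets reals.
Set Implicit Arguments.
Unset Strict Implicit.
Unset Printing Implicit Defensive.
Import Order.TTheory GRing.Theory Num.Theory.
Local Open Scope classical_set_scope.
Local Open Scope ring_scope.

Definition column_lattice (n k : nat) (E : 'M[int]_(n, k)) : set 'cV[int]_n :=
  range (fun v : 'cV[int]_k => E *m v).

Definition reduction (p n : nat) (w : 'cV[int]_n) : 'cV['F_p]_n :=
  map_mx (fun z : int => z%:~R) w.

Definition hamming_dist (p n : nat) (u v : 'cV['F_p]_n) : nat :=
  #|[set i : 'I_n | u i 0 != v i 0]%SET|.

(* The subset S of F_p^n is an [n, k, d]_p-code; this includes S being a
   linear subspace. The bound d may be any real number. 'F_p is the field with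
   p elements only when p is prime. *)
Definition is_code (R : realType) (p n k : nat) (d : R)
    (S : set 'cV['F_p]_n) : Prop :=
  exists V : {vspace 'cV['F_p]_n},
    [/\ S = [set u | u \in V],
        \dim V = k
      & forall u v : 'cV['F_p]_n, S u -> S v -> u <> v ->
          d <= (hamming_dist u v)%:R].

(* Main.v *)
(* Take n = 2k and let H be the k x 2k adjacency matrix, with entries 0 and 1,
   of a bipartite graph of left degree 4 in which every nonempty set S of at
   most k/1024 left vertices has more than 2|S| neighbours; such a graph exists
   by a union bound over random graphs. Since S emits 4|S| edges, some right
   vertex is hit by exactly one of them, so over every field no nonzero vector
   supported in S is killed by H. The Smith normal form of H yields k integer
   columns E with H E = 0 and a left inverse over the integers. Hence modulo
   every prime p the columns of E stay independent and span a subspace of the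
   kernel of H, in which nonzero vectors have weight above k/1024 = n/2048. *)
Require Import Defs.
From mathcomp Require Import all_boot all_order all_algebra.
From mathcomp Require Import classical_sets reals.
From mathcomp Require Import zify ring.
Import Order.TTheory GRing.Theory Num.Theory.
Local Open Scope classical_set_scope.
Local Open Scope ring_scope.

(** * Binomial estimates *)

(** A crude Stirling bound: [s ^ s] is at most the falling factorial of [s + s] of length [s], which
    is the central binomial coefficient times [s]!, and that coefficient is at most [4 ^ s]. *)
Lemma expn_self_le_fact s : (s ^ s <= 4 ^ s * s`!)%N.
Proof.
have hffact m n : (n ^ m <= (n + m) ^_ m)%N.
  elim: m n => [|m IHm] n; first by rewrite ffactn0.
  by rewrite addnS ffactnS expnS leq_mul //; lia.
have hbin : ('C(s + s, s) <= 4 ^ s)%N.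
  rewrite (_ : 4 = 2 ^ 2)%N // -expnM mul2n -addnn.
  have := expnDn 1 1 (s + s); rewrite addn1 => ->.
  have hs : (s < (s + s).+1)%N by lia.
  rewrite (bigD1 (Ordinal hs)) //= !exp1n !muln1; exact: leq_addr.
apply: leq_trans (hffact s s) _.
by rewrite -bin_ffact leq_mul2r hbin orbT.
Qed.

(** The usual bound (en/s)^s with 4 in place of e, stated without division. *)
Lemma bin_mul_expn_le n s : ('C(n, s) * s ^ s <= (4 * n) ^ s)%N.
Proof.
have hle m : (n ^_ m <= n ^ m)%N.
  elim: m => [|m IHm]; first by rewrite ffactn0.
  by rewrite ffactnSr expnSr leq_mul // leq_subr.
apply: (@leq_trans (4 ^ s * n ^_ s)%N); last by rewrite expnMn leq_mul.
rewrite -bin_ffact mulnCA leq_mul //; exact: expn_self_le_fact.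
Qed.

Lemma union_bound_term_le k s : (0 < s)%N -> (1024 * s <= k)%N ->
  (2 ^ s * ('C(k + k, s) * 'C(k, 2 * s) * (2 * s) ^ (4 * s)) <= k ^ (4 * s))%N.
Proof.
move=> s_gt0 hsk.
have spos : (0 < s ^ s)%N by rewrite expn_gt0 s_gt0.
rewrite -(leq_pmul2r spos).
have h1 := bin_mul_expn_le (k + k) s.
have h2 := bin_mul_expn_le k (2 * s).
have -> : (2 ^ s * ('C(k + k, s) * 'C(k, 2 * s) * (2 * s) ^ (4 * s)) * s ^ s
  = 2 ^ s * ('C(k + k, s) * s ^ s) * ('C(k, 2 * s) * (2 * s) ^ (2 * s))
    * (2 * s) ^ (2 * s))%N.
  rewrite (_ : 4 * s = 2 * s + 2 * s)%N; last by lia.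
  by rewrite expnD; ring.
apply: (@leq_trans (2 ^ s * (4 * (k + k)) ^ s * (4 * k) ^ (2 * s)
    * (2 * s) ^ (2 * s))%N); first by rewrite !leq_mul.
(* Both sides are now [s]-th powers, so it suffices to compare bases: the constants 2, 8, 16 and 4
   multiply to 1024, the source of the threshold on [s]. *)
rewrite !expnM -!expnMn leq_exp2r //.
have -> : (2 * (4 * (k + k)) * (4 * k) ^ 2 * (2 * s) ^ 2
  = 1024 * s * (k ^ 3 * s))%N by ring.
have -> : (k ^ 4 * s = k * (k ^ 3 * s))%N by ring.
by rewrite leq_mul2r hsk orbT.
Qed.

(** * Counting maps and unique neighbours *)

Lemma exists_card_superset (T : finType) (A : {set T}) m :
  (#|A| <= m <= #|T|)%N -> exists2 B : {set T}, A \subset B & #|B| = m.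
Proof.
move=> /andP[hA hm].
have [|hlt] := leqP (m - #|A|) (size (enum (~: A)%SET)); last first.
  by move: hlt; have := cardE (~: A)%SET; have := cardsC A; lia.
move=> hsz; exists (A :|: [set x in take (m - #|A|) (enum (~: A)%SET)])%SET.
  exact: finset.subsetUl.
have hB : #|[set x in take (m - #|A|) (enum (~: A)%SET)]%SET| = (m - #|A|)%N.
  by rewrite cardsE (card_uniqP _) ?take_uniq ?enum_uniq // size_takel.
rewrite cardsU hB (_ : (_ :&: _)%SET = finset.set0) ?cards0; first by lia.
apply/setP => x; rewrite !inE; apply/negP => /andP[xA /mem_take].
by rewrite mem_enum inE xA.
Qed.

(** Values at distinct edges are chosen independently: edges leaving [S] have #|T| choices, all
    others #|K|. *)
Lemma card_ffun_maps_into (I J K : finType) (S : {set I}) (T : {set K}) :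
  #|[set f : {ffun I * J -> K} |
      f @: finset.setX S [set: J]%SET \subset T]%SET|
  = (#|T| ^ (#|J| * #|S|) * #|K| ^ (#|J| * (#|I| - #|S|)))%N.
Proof.
pose F (x : I * J) : {set K} := if x.1 \in S then T else [set: K]%SET.
have -> : #|[set f : {ffun I * J -> K} |
      f @: finset.setX S [set: J]%SET \subset T]%SET|
    = #|family (fun x => mem (F x))|.
  apply: eq_card => f; rewrite [LHS]inE.
  apply/idP/idP => [/fintype.subsetP h|/familyP h].
    apply/familyP => x; rewrite /F; case: ifP => xS; last by rewrite inE.
    by apply: h; apply: imset_f; rewrite !inE xS.
  apply/fintype.subsetP => x /imsetP[y]; rewrite !inE andbT => yS ->.
  by have := h y; rewrite /F yS.
rewrite card_family.
have -> : foldr muln 1%N [seq #|mem (F x)| | x : I * J] = (\prod_x #|F x|)%N.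
  by rewrite foldrE big_map big_enum.
rewrite -(pair_big xpredT xpredT (fun i j => #|F (i, j)|)) /=.
have prodF i : (\prod_(j : J) #|F (i, j)| =
    #|if i \in S then T else [set: K]%SET| ^ #|J|)%N.
  by rewrite -prod_nat_const; apply: eq_bigl.
rewrite (bigID (mem S)) /=; congr (_ * _)%N.
  rewrite (eq_bigr (fun=> #|T| ^ #|J|)%N); last by move=> i iS; rewrite prodF iS.
  by rewrite prod_nat_const -expnM.
rewrite (eq_bigr (fun=> #|K| ^ #|J|)%N); last first.
  by move=> i /negbTE iS; rewrite prodF iS cardsT.
rewrite prod_nat_const -expnM; congr (_ ^ (_ * _))%N.
rewrite -(cardsC S) addKn; apply: eq_card => i; by rewrite !inE.
Qed.

(** Double counting: if every neighbour of [S] received at least two edges, the #|S| * #|J| edges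
    would be at least twice as many as the neighbours. So some fibre is a single edge. *)
Lemma unique_neighbour (I J K : finType) (f : I * J -> K) (S : {set I}) :
  (#|S| * #|J| < 2 * #|f @: finset.setX S [set: J]%SET|)%N ->
  exists i, exists2 j, i \in S &
    forall i' j', i' \in S -> f (i', j') = f (i, j) -> i' = i.
Proof.
set X := finset.setX S [set: J]%SET => hlt.
have hX : #|X| = (#|S| * #|J|)%N by rewrite cardsX cardsT.
have hsum : (#|X| = \sum_(t in f @: X) #|[set x in X | f x == t]%SET|)%N.
  rewrite -sum1_card (partition_big_imset f) /=; apply: eq_bigr => t _.
  by rewrite -sum1_card; apply: eq_bigl => x; rewrite inE.
have [/existsP[t /andP[tX /cards1P[[i j] hij]]]|] :=
  boolP [exists t in f @: X, #|[set x in X | f x == t]%SET| == 1%N].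
  have := set11 (i, j); rewrite -hij !inE andbT => /andP[iS /eqP ft].
  exists i, j => // i' j' i'S e.
  have : (i', j') \in [set x in X | f x == t]%SET by rewrite !inE i'S e ft eqxx.
  by rewrite hij inE => /eqP[].
rewrite negb_exists => /forallP h.
move: hlt; rewrite -hX ltnNge hsum mulnC -sum_nat_const => /negP[].
apply: leq_sum => t tX; have := h t; rewrite tX /=.
have : (0 < #|[set x in X | f x == t]%SET|)%N.
  case/imsetP: (tX) => x xX ->; apply/card_gt0P; exists x.
  by rewrite inE xX eqxx.
by case: #|_| => [|[]].
Qed.

(** * Existence of expanders *)

Lemma sum_geometric_half N :
  \sum_(0 <= s < N) (2^-1 : rat) ^+ s.+1 = 1 - 2^-1 ^+ N.
Proof.
elim: N => [|N IH]; first by rewrite big_geq // subrr.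
by rewrite big_nat_recr //= IH exprS; field.
Qed.

(* Union bound over S and over sets T of size 2|S| containing all neighbours of
   S: the graphs bad for some S of size s make up at most a fraction 2^-s. *)
Lemma exists_expander k : (0 < k)%N ->
  exists f : {ffun 'I_(k + k) * 'I_4 -> 'I_k},
    forall S : {set 'I_(k + k)}, S != finset.set0 -> (1024 * #|S| <= k)%N ->
      (2 * #|S| < #|f @: finset.setX S [set: 'I_4]%SET|)%N.
Proof.
move=> k_gt0.
pose good S := (S != finset.set0 :> {set 'I_(k + k)}) && (1024 * #|S| <= k)%N.
pose ev S T : {set {ffun 'I_(k + k) * 'I_4 -> 'I_k}} :=
  [set f : {ffun 'I_(k + k) * 'I_4 -> 'I_k} |
     f @: finset.setX S [set: 'I_4]%SET \subset (T : {set 'I_k})]%SET.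
pose bad := (\bigcup_(S | good S) \bigcup_(T : {set 'I_k} | #|T| == 2 * #|S|)
   ev S T)%SET.
have [/existsP[f fbad]|] := boolP [exists f, f \notin bad].
  exists f => S S0 hS; rewrite ltnNge; apply/negP => hle; move/negP: fbad; apply.
  (* A neighbourhood that is too small is enlarged to size exactly 2|S|, the only size over which
     [bad] ranges. *)
  have [|T hT cT] := @exists_card_superset _ (f @: finset.setX S [set: 'I_4]%SET)
    (2 * #|S|); first by rewrite hle card_ord; lia.
  apply/bigcupP; exists S; first by rewrite /good S0 hS.
  by apply/bigcupP; exists T; rewrite ?cT ?inE.
rewrite negb_exists => /forallP hbad.
pose K := (k ^ (4 * (k + k)))%N.
have hK : #|bad| = K.
  rewrite (_ : bad = [set: _]%SET) ?cardsT ?card_ffun ?card_prod ?card_ord.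
    by rewrite mulnC.
  by apply/setP => f; rewrite inE; have := hbad f; rewrite negbK.
(* Choices of [S], of [T], of the 4s edges from [S] into [T], and of the remaining edges. *)
pose term s := ('C(k + k, s) * 'C(k, 2 * s) *
   ((2 * s) ^ (4 * s) * k ^ (4 * (k + k - s))))%N.
have hub : (#|bad| <= \sum_(s < (k + k).+1 | (0 < s) && (1024 * s <= k)) term s)%N.
  have hun (I U : finType) (P : pred I) (F : I -> {set U}) :
      (#|(\bigcup_(i | P i) F i)%SET| <= \sum_(i | P i) #|F i|)%N.
    elim/big_rec2: _ => [|i n A _ h]; first by rewrite cards0.
    by apply: leq_trans (leq_card_setU _ _) _; rewrite leq_add2l.
  apply: leq_trans (hun _ _ _ _) _.
  pose sz (S : {set 'I_(k + k)}) : 'I_(k + k).+1 := inord #|S|.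
  have szE S : sz S = #|S| :> nat.
    by rewrite inordK // ltnS -[X in (_ <= X)%N](card_ord (k + k)) max_card.
  rewrite (partition_big sz (fun s => (0 < s) && (1024 * s <= k))%N) /=; last first.
    by move=> S /andP[S0 h]; rewrite szE h card_gt0 S0.
  apply: leq_sum => s /andP[s0 hs].
  apply: (@leq_trans (\sum_(S : {set 'I_(k + k)} | #|S| == s)
     'C(k, 2 * s) * ((2 * s) ^ (4 * s) * k ^ (4 * (k + k - s))))%N); last first.
    by rewrite sum_nat_cond_const card_draws card_ord mulnA.
  rewrite (eq_bigl (fun S : {set 'I_(k + k)} => #|S| == s)); last first.
    move=> S; rewrite -val_eqE /= szE /good -card_gt0.
    by case: eqP => [->|]; rewrite ?s0 ?hs ?andbF.
  apply: leq_sum => S /eqP cS.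
  apply: leq_trans (hun _ _ _ _) _; rewrite cS.
  rewrite (eq_bigr (fun=> (2 * s) ^ (4 * s) * k ^ (4 * (k + k - s))))%N.
    by rewrite sum_nat_cond_const card_draws card_ord.
  by move=> T /eqP cT; rewrite card_ffun_maps_into cT cS !card_ord.
have hterm s : (0 < s)%N -> (1024 * s <= k)%N ->
    (term s)%:R <= K%:R * (2^-1 : rat) ^+ s.
  move=> s0 hs; rewrite exprVn ler_pdivlMr ?exprn_gt0 // -natrX -natrM ler_nat.
  have -> : K = (k ^ (4 * s) * k ^ (4 * (k + k - s)))%N.
    by rewrite -expnD -mulnDr subnKC //; lia.
  rewrite /term mulnC !mulnA leq_mul2r; apply/orP; right.
  by rewrite -!mulnA !(mulnA 'C(_, _)); exact: union_bound_term_le.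
(* If all [K] maps were bad, then [K] would be at most [K] times a partial sum of the geometric
   series without its term 1, which stays strictly below [K]. *)
suff : (K%:R < K%:R :> rat) by rewrite ltxx.
have K0 : (0 < K)%N by rewrite expn_gt0 k_gt0.
apply: (@le_lt_trans _ _ (K%:R * \sum_(0 <= s < k + k) (2^-1 : rat) ^+ s.+1)).
  rewrite -{1}hK; apply: (@le_trans _ _
    (\sum_(s < (k + k).+1 | (0 < s)%N && (1024 * s <= k)%N) (term s)%:R)).
    by rewrite -natr_sum ler_nat.
  rewrite mulr_sumr big_mkord big_mkcond big_ord_recl /= add0r.
  apply: ler_sum => s _; rewrite /bump /= add1n.
  case: ifP => [h|_]; first exact: hterm.
  by rewrite mulr_ge0 ?exprn_ge0.
rewrite sum_geometric_half gtr_pMr ?ltr0n // gtrBl exprn_gt0 //.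
Qed.

(** * Integer kernels and supports of kernel vectors *)

(** In the Smith form P D Q of [H] the last [k] columns of D vanish. So the last [k] columns of the
    inverse of Q are killed by [H], and the last [k] rows of Q are a left inverse to them. *)
Lemma left_invertible_in_kernel m k (H : 'M[int]_(m, m + k)) :
  exists (E : 'M[int]_(m + k, k)) (L : 'M[int]_(k, m + k)),
    H *m E = 0 /\ L *m E = 1%:M.
Proof.
have [P _ [Q Qu [d _ ->]]] := int_Smith_normal_form H.
exists (invmx Q *m col_mx 0 1%:M), (row_mx 0 1%:M *m Q).
split; last by rewrite -mulmxA mulKVmx // mul_row_col !mul0mx mul1mx add0r.
rewrite -!mulmxA mulKVmx // -[X in P *m X](_ : 0 = _) ?mulmx0 //.
rewrite -[X in X *m _]hsubmxK mul_row_col mulmx0 add0r mulmx1.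
apply/matrixP => i j; rewrite !mxE /=.
by rewrite ltn_eqF // (leq_trans (ltn_ord i)) // leq_addr.
Qed.

(** Parallel edges count once, so entries are 0 or 1 and a nonzero entry stays nonzero in every
    field. *)
Definition adjacency_mx {n m d} (f : 'I_n * 'I_d -> 'I_m) : 'M[int]_(m, n) :=
  \matrix_(j, i) [exists c, f (i, c) == j]%:R.

(** In the row of a unique neighbour of the support, the product with [w] has a single nonzero term,
    so it cannot vanish. *)
Lemma support_unique_neighbour {F : fieldType} {n m d} (f : 'I_n * 'I_d -> 'I_m)
    {w : 'cV[F]_n} :
  map_mx intr (adjacency_mx f) *m w = 0 ->
  (2 * #|f @: finset.setX [set i | (w i 0 != 0)%R]%SET [set: 'I_d]%SET|
    <= #|[set i | (w i 0 != 0)%R]%SET| * d)%N.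
Proof.
move=> Hw; set S := [set i | _]%SET; rewrite leqNgt; apply/negP => hlt.
have [|i [c iS hi]] := @unique_neighbour _ _ _ f S; first by rewrite card_ord.
have /matrixP/(_ (f (i, c)) 0) := Hw.
rewrite !mxE (bigD1 i) //= big1 ?addr0.
  rewrite !mxE (_ : [exists _, _] = true) ?mul1r; last first.
    by apply/existsP; exists c.
  by move/eqP; apply/negP; move: iS; rewrite inE.
move=> i' ne; rewrite !mxE; case: existsP => [[c' /eqP e]|_]; last by rewrite mul0r.
have [->|wi'] := eqVneq (w i' 0) 0; first by rewrite mulr0.
by rewrite (hi i' c') ?eqxx ?inE // in ne.
Qed.

(** * The code modulo p *)

Lemma reduction_surj p n (v : 'cV['F_p]_n) : exists w, reduction p w = v.
Proof.
exists (map_mx (fun z : 'F_p => (z : nat)%:Z) v).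
by apply/matrixP => i j; rewrite !mxE; exact: natr_Zp.
Qed.

Theorem proposition4p2 (R : realType) :
  exists C delta : R,
    [/\ 1 <= C,
        0 < delta
      & forall k : nat, exists (n : nat) (E : 'M[int]_(n, k)),
          n%:R <= C * k%:R /\
          (forall p : nat, prime p ->
             is_code k (delta * n%:R)
               (reduction p (n := n) @` column_lattice E))].
Proof.
exists 2, 2048^-1; split; [by rewrite ler1n | by rewrite invr_gt0 ltr0n |].
move=> k.
have [f hf] : exists f : 'I_(k + k) * 'I_4 -> 'I_k,
    forall S : {set 'I_(k + k)}, S != finset.set0 -> (1024 * #|S| <= k)%N ->
      (2 * #|S| < #|f @: finset.setX S [set: 'I_4]%SET|)%N.
  (* For [k] = 0 there are no left vertices, so no nonempty [S]. *)
  have [k0|k_gt0] := posnP k.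
    have no (x : 'I_(k + k)) : False by case: x => x; rewrite k0.
    exists (fun x => False_rect _ (no x.1)) => S /set0Pn[x].
    by case: (no x).
  by have [f hf] := exists_expander k k_gt0; exists f.
have [E [L [HE LE]]] := left_invertible_in_kernel k k (adjacency_mx f).
exists (k + k)%N, E; split; first by rewrite natrD mulrDl mul1r.
move=> p p_pr.
have redM m n q (A : 'M[int]_(m, n)) (B : 'M[int]_(n, q)) :
    map_mx (intr : int -> 'F_p) (A *m B) = map_mx intr A *m map_mx intr B.
  exact: map_mxM.
pose Ep : 'M['F_p]_(k + k, k) := map_mx intr E.
pose phi : 'Hom('cV['F_p]_k, 'cV['F_p]_(k + k)) := linfun (mulmx Ep).
have phiE x : phi x = Ep *m x by rewrite lfunE.
have LEp : map_mx intr L *m Ep = 1%:M.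
  by rewrite -redM LE map_mx1.
have SE : reduction p (n := k + k) @` column_lattice E
    = [set u | u \in limg phi].
  apply/seteqP; split => [u [_ [v _ <-] <-]|u /memv_imgP[v _ ->]] /=.
    apply/memv_imgP; exists (reduction p v); first exact: memvf.
    by rewrite phiE /reduction redM.
  have [w <-] := reduction_surj _ _ v.
  by exists (E *m w); [exists w | rewrite phiE /reduction redM].
exists (limg phi); split => //.
  (* The integer left inverse [L] reduces modulo [p], so [phi] is injective. *)
  rewrite limg_dim_eq ?dimvf ?dim_matrix; first exact: muln1.
  apply/eqP; rewrite (_ : lker phi = 0%VS) ?capv0 //; apply/eqP/lker0P => x y.
  rewrite !phiE => /(congr1 (mulmx (map_mx intr L))).
  by rewrite !mulmxA LEp !mul1mx.
move=> u v; rewrite SE /= => uV vV neq.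
set S := [set i | (u - v) i 0 != 0]%SET.
have dE : hamming_dist u v = #|S|.
  by apply: eq_card => i; rewrite !inE !mxE subr_eq0.
have Hw : map_mx intr (adjacency_mx f) *m (u - v) = 0.
  have : u - v \in limg phi by rewrite rpredB.
  by case/memv_imgP => x _ ->; rewrite phiE mulmxA -redM HE map_mx0 mul0mx.
have hS := support_unique_neighbour _ Hw.
have S0 : S != finset.set0.
  apply: contra_not_neq neq => S0; apply/matrixP => i j; rewrite ord1.
  apply/eqP; rewrite -subr_eq0; apply/eqP/eqP; apply: contraT => h.
  by have := finset.in_set0 i; rewrite -S0 inE !mxE h.
(* For smaller [S], expansion would give more than 2|S| neighbours, while [hS] allows at most
   2|S|. *)
have hk : (k < 1024 * #|S|)%N.
  rewrite ltnNge; apply/negP => /(hf S S0).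
  rewrite ltnNge -(leq_pmul2l (isT : (0 < 2)%N)) mulnA => /negP[].
  by rewrite (leq_trans hS) // mulnC.
rewrite dE mulrC ler_pdivrMr ?ltr0n // -natrM ler_nat; lia.
Qed.
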